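(* Let $S$ be a compact metrizable space, let $\boldsymbol{X} = (X_0, X_1,\dots)$ be a sequence of $S$-valued random variables on a probability space $(\Omega,\mathscr F,\mathbb P)$, and let $\boldsymbol{\xi} = (\xi_0, \xi_1,\dots)$ be a product disintegration of $\boldsymbol{X}$. Let $f\colon S\to\mathbb{R}$ be continuous. Then \[ \mathbb{P}\left(\lim_{n\to\infty} \frac1n\sum_{i=0}^{n-1}\big(f( X_i) - \xi_i(f)\big) = 0\right)= 1. \] In particular, the limit $X_\infty(f)\coloneqq \lim_{n\to\infty} n^{-1}\sum_{i=0}^{n-1}f( X_i)$ exists almost surely if and only if the limit $\xi_\infty(f)\coloneqq \lim_{n\to\infty}n^{-1}\sum_{i=0}^{n-1}\xi_i(f)$ exists almost surely, in which case $X_\infty(f) = \xi_\infty(f)$ almost surely.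
   Context: $M_1(S)$ denotes the set of Borel probability measures on $S$, equipped with the weak topology and its Borel $\sigma$-field; a random probability measure on $S$ is a measurable map $\xi\colon\Omega\to M_1(S)$. For $\mu\in M_1(S)$ and $f\in C(S)$, $\mu(f)\coloneqq\int_S f\,d\mu$. A sequence $\boldsymbol\xi=(\xi_0,\xi_1,\dots)$ of random probability measures on $S$ is a product disintegration of $\boldsymbol X$ if, with probability one, $\mathbb{P}[X_0\in A_0,\dots,X_n\in A_n\mid \boldsymbol{\xi}] = \xi_0(A_0)\cdots\xi_n(A_n)$ holds simultaneously for every $n\ge 0$ and every family $A_0,\dots,A_n$ of Borel subsets of $S$ (conditioning is on $\sigma(\boldsymbol\xi)$). *)

(* Defs.v *)
From HB Require Import structures.
From mathcomp Require Import all_boot all_order all_algebra.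
From mathcomp Require Import all_classical all_reals all_analysis.
Set Implicit Arguments. Unset Strict Implicit. Unset Printing Implicit Defensive.
Import Order.TTheory GRing.Theory Num.Theory.
Import numFieldNormedType.Exports.
Local Open Scope classical_set_scope.
Local Open Scope ring_scope.

Notation borel S := (g_sigma_algebraType (@open S)).

(* mu(f) := \int_S f dmu, as a real number (f continuous on a compact space,
   hence bounded, so the integral is finite). *)
Definition mint {R : realType} {S : ptopologicalType}
  (mu : probability (borel S) R) (f : S -> R) : R :=
  Rintegral mu setT f.

(* A random probability measure on S is a measurable map
   Omega -> M_1(S), where M_1(S) carries the Borel sigma-field of the weak
   topology, i.e. the sigma-field generated by the maps mu |-> mu(f),
   f in C(S). *)
Definition random_prob_measure {d} {T : measurableType d} {R : realType}
  {S : ptopologicalType} (xi : T -> probability (borel S) R) : Prop :=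
  forall f : S -> R, continuous f -> measurable_fun setT (fun w => mint (xi w) f).

Definition sigma_gen {T : Type} {R : realType} {S : ptopologicalType}
  (xi : nat -> T -> probability (borel S) R) : set (set T) :=
  <<s [set A | exists (i : nat) (f : S -> R) (B : set R),
        [/\ continuous f, measurable B & A = [set w | B (mint (xi i w) f)]]] >>.

(* xi is a product disintegration of X: for every n and every Borel
   A_0, ..., A_n, the random variable xi_0(A_0) ... xi_n(A_n) is a version of
   the conditional probability P[X_0 in A_0, ..., X_n in A_n | sigma(xi)],
   i.e. it is sigma(xi)-measurable and integrates correctly over every event of
   sigma(xi). *)
Definition product_disintegration {d} {T : measurableType d} {R : realType}
  {S : ptopologicalType} (P : probability T R) (X : nat -> T -> borel S)
  (xi : nat -> T -> probability (borel S) R) : Prop :=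
  forall (n : nat) (A : nat -> set (borel S)), (forall k, measurable (A k)) ->
    let Y := fun w => \prod_(k < n.+1) fine (xi k w (A k)) in
    (forall B : set R, measurable B -> sigma_gen xi (Y @^-1` B)) /\
    (forall G : set T, sigma_gen xi G ->
       P ([set w | forall k, (k <= n)%N -> A k (X k w)] `&` G)
       = (\int[P]_(w in G) (Y w)%:E)%E).

(* Cesaro averages n^-1 \sum_{i<n} u_i  (for n = 0 this is 0). *)
Definition cesaro_mean {R : realType} (u : nat -> R) : nat -> R :=
  fun n => n%:R^-1 * \sum_(i < n) u i.

(* Main.v *)
(* For a bounded measurable g on S put D_i(g) = g(X_i) - xi_i(g). If g is an
   indicator, disintegration makes the D_i(g) pairwise orthogonal and bounded by
   1, so E[(n^-1 \sum_(i < n) D_i(g))^2] <= 1/n; these bounds are summable along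
   the squares n = k^2, and consecutive squares are close enough for bounded
   terms to fill the gaps. A continuous f is a uniform limit of finite
   combinations of indicators, with exceptional null sets that are countably
   many, which gives almost sure convergence for f. *)
Require Import Defs.
From HB Require Import structures.
From mathcomp Require Import all_boot all_order all_algebra.
From mathcomp Require Import all_classical all_reals all_analysis.
From mathcomp Require Import measurable_realfun ring lra zify.
Set Implicit Arguments. Unset Strict Implicit. Unset Printing Implicit Defensive.
Import Order.TTheory GRing.Theory Num.Theory.
Import numFieldNormedType.Exports.
Local Open Scope classical_set_scope.
Local Open Scope ring_scope.

(** * Cesaro means of real sequences *)

Lemma cesaro_mean_normr_le (R : realType) (u : nat -> R) (c : R) (n : nat) :
  (forall i, `|u i| <= c) -> `|cesaro_mean u n| <= c.
Proof.
move=> uc; have c0 : 0 <= c by exact: le_trans (uc 0%N).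
rewrite /cesaro_mean normrM ger0_norm ?invr_ge0//.
(* At [n = 0] the inverse of 0 is 0, so the mean is 0 and the bound reduces to [0 <= c]. *)
case: n => [|n]; first by rewrite invr0 mul0r.
rewrite ler_pdivrMl// (le_trans (ler_norm_sum _ _ _))//.
rewrite (le_trans (ler_sum _ (fun (i : 'I_n.+1) _ => uc i)))//.
by rewrite sumr_const card_ord mulr_natl.
Qed.

Lemma cesaro_meanB (R : realType) (u v : nat -> R) (n : nat) :
  cesaro_mean (fun i => u i - v i) n = cesaro_mean u n - cesaro_mean v n.
Proof. by rewrite /cesaro_mean sumrB mulrBr. Qed.

Lemma cesaro_meanZ (R : realType) (a : R) (u : nat -> R) (n : nat) :
  cesaro_mean (fun i => a * u i) n = a * cesaro_mean u n.
Proof. by rewrite /cesaro_mean -mulr_sumr mulrCA. Qed.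

Lemma cesaro_mean_sum (R : realType) (I : finType) (u : I -> nat -> R) (n : nat) :
  cesaro_mean (fun i => \sum_k u k i) n = \sum_k cesaro_mean (u k) n.
Proof. by rewrite /cesaro_mean exchange_big mulr_sumr. Qed.

(** Averaging does not enlarge a uniform error: the means of [u] and [v] differ by at most [e] at
    every index. This lets indicators stand in for a continuous function along one fixed
    trajectory. *)
Lemma cesaro_cvg0_approx (R : realType) (u : nat -> R) :
  (forall e, 0 < e -> exists2 v, cesaro_mean v @ \oo --> (0 : R) &
    forall i, `|u i - v i| <= e) ->
  cesaro_mean u @ \oo --> (0 : R).
Proof.
move=> uv; apply/cvgrPdist_le => e e0.
have [v v0 uve] := uv (e / 2) ltac:(lra).
move/cvgrPdist_le : v0 => /(_ (e / 2) ltac:(lra)) v0.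
near=> n.
have vn : `|0 - cesaro_mean v n| <= e / 2 by near: n.
have := @cesaro_mean_normr_le R (fun i => u i - v i) (e / 2) n uve.
rewrite cesaro_meanB => h.
rewrite sub0r normrN in vn; rewrite sub0r normrN.
rewrite -(subrK (cesaro_mean v n) (cesaro_mean u n)).
rewrite (le_trans (ler_normD _ _))//; lra.
Unshelve. all: by end_near. Qed.

(** Between consecutive squares there are at most [2 * k.+1] extra terms, each bounded by 1. After
    division by [n >= k.+1 ^ 2] they contribute at most [2 / k.+1]. *)
Lemma cesaro_cvg0_squares (R : realType) (u : nat -> R) :
  (forall i, `|u i| <= 1) ->
  cesaro_mean u (k.+1 ^ 2)%N @[k --> \oo] --> (0 : R) ->
  cesaro_mean u @ \oo --> (0 : R).
Proof.
move=> u1 sq0; apply/cvgrPdist_le => e e0.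
move/cvgrPdist_le : sq0 => /(_ (e / 2) ltac:(lra)) sq0.
have inv0 : \forall k \near \oo, (k.+1%:R)^-1 < e / 4 :> R.
  by apply: near_infty_natSinv_lt (PosNum (_ : 0 < e / 4)); lra.
have [K _ HK] : \forall k \near \oo,
    `|0 - cesaro_mean u (k.+1 ^ 2)%N| <= e / 2 /\ (k.+1%:R)^-1 < e / 4 :> R.
  by apply: filterI.
exists (K.+1 ^ 2)%N => // n /= Kn.
(* [k.+1 ^ 2] is the largest square not exceeding [n]; the induction on [n] moves to the next [k]
   exactly when [n] reaches [k.+2 ^ 2]. *)
have [k [Kk kn nk]] : exists k, [/\ (K <= k)%N, (k.+1 ^ 2 <= n)%N & (n < k.+2 ^ 2)%N].
  elim: n Kn => [|n IH]; first by rewrite leqn0 expn_eq0.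
  rewrite leq_eqVlt => /orP[/eqP<-|/IH[k [Kk kn nk]]].
    by exists K; split => //; rewrite ltn_exp2r.
  have [nk'|nk'] := ltnP n.+1 (k.+2 ^ 2)%N.
    by exists k; split => //; exact: leqW.
  exists k.+1; split => //; first exact: leqW.
  by rewrite (leq_ltn_trans nk)// ltn_exp2r.
have [] := HK k Kk; rewrite !sub0r !normrN => ck ke.
have n0 : (0 < n)%N by rewrite (leq_trans _ kn)// expn_gt0.
have s2 : (0 : R) < (k.+1 ^ 2)%N%:R by rewrite ltr0n expn_gt0.
have k0 : (0 : R) < k.+1%:R by [].
have n0R : (0 : R) < n%:R by rewrite ltr0n.
have E1 : `|\sum_(i < n) u i| <= `|\sum_(i < (k.+1 ^ 2)%N) u i| + 2 * k.+1%:R.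
  rewrite -!(big_mkord xpredT u) (@big_cat_nat _ _ _ (k.+1 ^ 2)%N)//=.
  rewrite (le_trans (ler_normD _ _))// lerD2l.
  rewrite (le_trans (ler_norm_sum _ _ _))//.
  rewrite (le_trans (ler_sum _ (fun i _ => u1 i)))//.
  (* The strict bound [n < k.+2 ^ 2] leaves at most [2k + 2] terms, one fewer than the gap [2k + 3]
     between the squares. *)
  rewrite sumr_const_nat -natrM ler_nat.
  move: kn nk; rewrite !expnS !expn0; lia.
have inv_norm m : `|m%:R^-1| = m%:R^-1 :> R by rewrite ger0_norm.
move: ck; rewrite /cesaro_mean !normrM !inv_norm.
rewrite ler_pdivrMl// => bE.
rewrite ler_pdivrMl// (le_trans E1)//.
(* This is where the threshold [e / 4] is used: the filling terms cost at most [e / 2], and the mean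
   at the square costs the other half. *)
have : 2 * k.+1%:R <= (k.+1 ^ 2)%N%:R * (e / 2).
  have : 1 < e / 4 * k.+1%:R by rewrite -ltr_pdivrMr// div1r.
  rewrite natrX; nra.
have : (k.+1 ^ 2)%N%:R <= n%:R :> R by rewrite ler_nat.
nra.
Qed.

(** * Staircase approximation by superlevel sets *)

(** The sum counts the integers of 1..N that are at most [y], so it is the floor of [y] truncated at
    [N]. *)
Lemma sum_indic_le_floor (R : realType) (N : nat) (y : R) : 0 <= y ->
  let s : R := \sum_(k < N) (k.+1%:R <= y)%R%:R in
  [/\ s <= y, s <= N%:R & s = N%:R \/ y < s + 1].
Proof.
move=> y0; elim: N => [|N] /=; first by rewrite big_ord0; split => //; left.
rewrite big_ord_recr/=; set s := \sum_(_ < _) _ => -[sy sN sP].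
have [yN|yN] := leP (N.+1%:R) y; rewrite ?addr0 -natr1 in yN *.
- case: sP => [sE|]; last by lra.
  by rewrite sE; split => //; left.
- split => //; [lra|right; case: sP => [->//|//]].
Qed.

(** The staircase is [g x] rounded down to a multiple of the mesh [1 / n.+1]. The error is uniform
    in [x], and only superlevel sets of [g] occur. *)
Lemma staircase_approx (R : realType) (T : Type) (g : T -> R) (n : nat) (x : T) :
  0 <= g x <= 1 ->
  `|g x - n.+1%:R^-1 * \sum_(k < n.+1) \1_[set t | k.+1%:R / n.+1%:R <= g t] x|
    <= n.+1%:R^-1.
Proof.
move=> /andP[g0 g1].
have n0 : (0 : R) < n.+1%:R by [].
have -> : \sum_(k < n.+1) \1_[set t | k.+1%:R / n.+1%:R <= g t] x =
    \sum_(k < n.+1) (k.+1%:R <= n.+1%:R * g x)%R%:R :> R.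
  apply: eq_bigr => k _; rewrite indicE [n.+1%:R * _]mulrC -ler_pdivrMr//.
  by congr ((nat_of_bool _)%:R); apply/idP/idP => [/set_mem//|h]; exact/mem_set.
have [|] := @sum_indic_le_floor R n.+1 (n.+1%:R * g x); first by nra.
set s := \sum_(_ < _) _ => sy sN sP.
(* After scaling by [n.+1] the rounding error must be at most 1. In the truncated case [s = n.+1] it
   is 0, because [g x <= 1]. *)
rewrite -(ler_pM2l n0) -{1}(gtr0_norm n0) -normrM mulrBr mulrA divff ?gt_eqF//.
rewrite mul1r ler_norml; case: sP => [sE|]; [rewrite sE in sy *|]; nra.
Qed.

(** * Integrals of bounded functions under a probability measure *)

Lemma integrable_bounded d (T : measurableType d) (R : realType)
  (mu : probability T R) (g : T -> R) (c : R) :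
  measurable_fun setT g -> (forall x, `|g x| <= c) ->
  mu.-integrable setT (EFin \o g).
Proof.
move=> mg gc; apply: measurable_bounded_integrable => //.
  by rewrite (le_lt_trans (probability_le1 mu measurableT))// ltry.
exists c; split; first exact: num_real.
by move=> y cy x _ /=; exact: le_trans (gc x) (ltW cy).
Qed.

Lemma normr_Rintegral_le d (T : measurableType d) (R : realType)
  (mu : probability T R) (g : T -> R) (c : R) :
  measurable_fun setT g -> (forall x, `|g x| <= c) ->
  `|\int[mu]_x g x| <= c.
Proof.
move=> mg gc; have ig := @integrable_bounded _ _ _ mu _ _ mg gc.
rewrite (le_trans (le_normr_Rintegral _ ig))//.
have -> : c = \int[mu]_x c.
  by rewrite Rintegral_cst// [X in fine X](probability_setT mu) mulr1.
apply: le_Rintegral => //.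
- apply: (@integrable_bounded _ _ _ _ _ c); first exact: measurableT_comp.
  by move=> x; rewrite normr_id.
- by apply: (@integrable_bounded _ _ _ _ _ `|c|).
Qed.

Lemma Rintegral_sum d (T : measurableType d) (R : realType)
  (mu : probability T R) (I : Type) (r : seq I) (h : I -> T -> R) :
  (forall i, mu.-integrable setT (EFin \o h i)) ->
  \int[mu]_x (\sum_(i <- r) h i x) = \sum_(i <- r) \int[mu]_x h i x.
Proof.
move=> ih; elim: r => [|i r IH].
  rewrite big_nil (_ : (fun _ => _) = cst 0); first by rewrite Rintegral_cst// mul0r.
  by apply/funext => x; rewrite big_nil.
rewrite big_cons -IH -RintegralD//.
  by apply: eq_Rintegral => x _; rewrite big_cons.
rewrite (_ : _ \o _ = fun x => \sum_(i <- r) (h i x)%:E)%E; last first.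
  by apply/funext => x /=; rewrite sumEFin.
by apply: (@integrable_sum _ _ _ mu _ _ _ r xpredT (fun i => EFin \o h i)).
Qed.

Lemma Rintegral_indic d (T : measurableType d) (R : realType)
  (mu : probability T R) (A : set T) :
  measurable A -> \int[mu]_x \1_A x = fine (mu A).
Proof. by move=> mA; rewrite /Rintegral integral_indic// setIT. Qed.

Lemma normr_indic_le1 (R : realType) (T : Type) (A : set T) (x : T) :
  `|\1_A x : R| <= 1.
Proof. by rewrite indicE; case: (_ \in _); rewrite ?normr1 ?normr0. Qed.

Lemma measurable_superlevel d (T : measurableType d) (R : realType)
  (g : T -> R) (c : R) :
  measurable_fun setT g -> measurable [set x | c <= g x].
Proof.
move=> mg; rewrite -[X in measurable X]setTI.
rewrite (_ : [set x | _] = g @^-1` `[c, +oo[); first exact: mg.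
by apply/seteqP; split => w /=; rewrite in_itv/= andbT.
Qed.

Lemma normr_sum_le_card (R : realType) (n : nat) (u : 'I_n -> R) :
  (forall i, `|u i| <= 1) -> `|\sum_(i < n) u i| <= n%:R.
Proof.
move=> u1; rewrite (le_trans (ler_norm_sum _ _ _))//.
rewrite [leRHS](_ : _ = \sum_(i < n) 1); first exact: ler_sum.
by rewrite sumr_const card_ord.
Qed.

(* The level sets of [Z] determine the integral because [Z] is a uniform limit of
   staircase combinations of their indicators. *)
Lemma Rintegral_indicB_mul_eq0 d (T : measurableType d) (R : realType)
  (P : probability T R) (U : set T) (Y Z : T -> R) :
  measurable U -> measurable_fun setT Y -> measurable_fun setT Z ->
  (forall w, 0 <= Y w <= 1) -> (forall w, 0 <= Z w <= 1) ->
  (forall c, P (U `&` [set w | c <= Z w])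
             = (\int[P]_(w in [set w | (c <= Z w)%R]) (Y w)%:E)%E) ->
  \int[P]_w ((\1_U w - Y w) * Z w) = 0.
Proof.
move=> mU mY mZ Y01 Z01 lev.
have mL c : measurable [set w | c <= Z w] by exact: measurable_superlevel.
have mUY : measurable_fun setT (fun w => \1_U w - Y w).
  by apply: measurable_funB => //; exact: measurable_indic.
have UY1 w : `|\1_U w - Y w| <= 1.
  have := Y01 w; rewrite indicE ler_norml.
  by case: (_ \in _) => /= /andP[]; lra.
have mI c : measurable_fun setT (\1_[set w | c <= Z w] : T -> R).
  exact: measurable_indic.
(* On a superlevel set, [lev] equates the integrals of [\1_U] and of [Y]; linearity then extends
   this to staircases. *)
have level0 c : \int[P]_w ((\1_U w - Y w) * \1_[set w | c <= Z w] w) = 0.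
  have -> : \int[P]_w ((\1_U w - Y w) * \1_[set w | c <= Z w] w) =
      \int[P]_w (\1_(U `&` [set w | c <= Z w]) w - (Y \_ [set w | c <= Z w]) w).
    apply: eq_Rintegral => w _; rewrite indicI patchE /= mulrBl; congr (_ - _).
    by rewrite indicE; case: (_ \in _); rewrite ?mulr1 ?mulr0.
  rewrite RintegralB//.
  - rewrite Rintegral_indic; last exact: measurableI.
    by rewrite lev -Rintegral_mkcond subrr.
  - apply: (@integrable_bounded _ _ _ _ _ 1); last exact: normr_indic_le1.
    by apply: measurable_indic; exact: measurableI.
  - apply: (@integrable_bounded _ _ _ _ _ 1).
      by apply/(measurable_restrictT _ _).1 => //; exact: measurable_funS mY.
    move=> w; rewrite patchE; case: ifP => _; last by rewrite normr0.
    by have /andP[Y0 Y1] := Y01 w; rewrite ger0_norm.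
apply/eqP; rewrite -normr_le0; apply/ler_addgt0Pr => e e0; rewrite add0r.
have [n _ /(_ n (leqnn _)) /= ne] := near_infty_natSinv_lt (PosNum e0).
pose st w := n.+1%:R^-1 * \sum_(k < n.+1) \1_[set w | k.+1%:R / n.+1%:R <= Z w] w : R.
have mst : measurable_fun setT st.
  by apply: measurable_funM => //; exact: measurable_sum.
have ib k : P.-integrable setT (EFin \o (fun w => (\1_U w - Y w) *
    \1_[set w | k.+1%:R / n.+1%:R <= Z w] w)).
  apply: (@integrable_bounded _ _ _ _ _ 1); first exact: measurable_funM.
  by move=> w; rewrite normrM mulr_ile1// normr_indic_le1.
have st0 : \int[P]_w ((\1_U w - Y w) * st w) = 0.
  have -> : \int[P]_w ((\1_U w - Y w) * st w) =
     \int[P]_w (n.+1%:R^-1 * \sum_(k < n.+1)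
       ((\1_U w - Y w) * \1_[set w | k.+1%:R / n.+1%:R <= Z w] w)).
    by apply: eq_Rintegral => w _; rewrite /st -mulr_sumr mulrCA.
  rewrite RintegralZl//.
    by rewrite Rintegral_sum// big1 ?mulr0.
  apply: (@integrable_bounded _ _ _ _ _ n.+1%:R).
    by apply: measurable_sum => k; exact: measurable_funM.
  move=> w; apply: normr_sum_le_card => k.
  by rewrite normrM mulr_ile1// normr_indic_le1.
have st1 w : `|Z w - st w| <= n.+1%:R^-1 by exact: staircase_approx.
(* Subtracting the vanishing integral [st0] leaves the factor [Z - st], which is uniformly below
   [e]. *)
have -> : \int[P]_w ((\1_U w - Y w) * Z w) =
    \int[P]_w ((\1_U w - Y w) * (Z w - st w)).
  rewrite -[LHS]subr0 -st0 -RintegralB//.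
  - by apply: eq_Rintegral => w _; rewrite mulrBr.
  - apply: (@integrable_bounded _ _ _ _ _ 1); first exact: measurable_funM.
    move=> w; rewrite normrM mulr_ile1//.
    by have /andP[? ?] := Z01 w; rewrite ger0_norm.
  (* The constant 2 comes from [|st| <= |Z| + |Z - st| <= 1 + 1]. *)
  - apply: (@integrable_bounded _ _ _ _ _ 2); first exact: measurable_funM.
    move=> w; rewrite normrM (le_trans (ler_wpM2r _ (UY1 w)))// mul1r.
    rewrite -[st w](subKr (Z w)) (le_trans (ler_normB _ _))// -[2]/(1 + 1) lerD//.
      by have /andP[? ?] := Z01 w; rewrite ger0_norm.
    by rewrite (le_trans (st1 w))// invf_le1// ler1n.
rewrite (le_trans _ (ltW ne))//; apply: normr_Rintegral_le.
  by apply: measurable_funM => //; exact: measurable_funB.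
move=> w; rewrite normrM (le_trans (ler_wpM2r _ (UY1 w)))// mul1r.
exact: st1.
Qed.

(** * A strong law for bounded orthogonal variables *)

(** Expanding the square, orthogonality kills the off-diagonal terms and leaves [n] diagonal ones,
    each at most 1. *)
Lemma Rintegral_sqr_sum_le d (T : measurableType d) (R : realType)
  (P : probability T R) (D : nat -> T -> R) (n : nat) :
  (forall i, measurable_fun setT (D i)) -> (forall i w, `|D i w| <= 1) ->
  (forall i j, (i != j)%N -> \int[P]_w (D i w * D j w) = 0) ->
  \int[P]_w ((\sum_(i < n) D i w) ^+ 2) <= n%:R.
Proof.
move=> mD D1 D0.
have mDD i j : measurable_fun setT (fun w => D i w * D j w).
  exact: measurable_funM.
have DD1 i j w : `|D i w * D j w| <= 1 by rewrite normrM mulr_ile1.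
have iDD i j : P.-integrable setT (EFin \o (fun w => D i w * D j w)).
  exact: (@integrable_bounded _ _ _ _ _ 1).
have -> : \int[P]_w ((\sum_(i < n) D i w) ^+ 2) =
    \int[P]_w (\sum_(i < n) \sum_(j < n) D i w * D j w).
  by apply: eq_Rintegral => w _; rewrite expr2 big_distrlr.
rewrite (@Rintegral_sum _ _ _ P _ _ (fun (i : 'I_n) w => \sum_(j < n) D i w * D j w)).
  rewrite (eq_bigr (fun i : 'I_n => \int[P]_w (D i w * D i w))).
    rewrite (_ : n%:R = \sum_(i < n) 1); last by rewrite sumr_const card_ord.
    apply: ler_sum => i _; rewrite (le_trans (ler_norm _))//.
    exact: normr_Rintegral_le.
  move=> i _; rewrite Rintegral_sum// (bigD1 i)//= big1 ?addr0// => j ji.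
  by rewrite D0// eq_sym.
move=> i; apply: (@integrable_bounded _ _ _ _ _ n%:R).
  exact: measurable_sum.
by move=> w; exact: normr_sum_le_card.
Qed.

Lemma sum_inv_sqr_le2 (R : realType) (n : nat) :
  \sum_(0 <= k < n) ((k.+1 ^ 2)%:R)^-1 <= 2 :> R.
Proof.
(* 1/(n+1)^2 <= 1/n - 1/(n+1) telescopes. *)
suff : \sum_(0 <= k < n.+1) ((k.+1 ^ 2)%:R)^-1 <= 2 - n.+1%:R^-1 :> R.
  rewrite big_nat_recr//= => h; apply: (le_trans _ (le_trans h _)).
    by rewrite lerDl invr_ge0.
  by rewrite gerBl invr_ge0.
elim: n => [|n IH]; first by rewrite big_nat1 exp1n invr1; lra.
rewrite big_nat_recr//= (le_trans (lerD IH (lexx _)))// natrX.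
have n0 : (0 : R) < n.+1%:R by [].
have n1 : (n.+2%:R : R) = n.+1%:R + 1 by rewrite -natr1.
rewrite n1 -subr_ge0.
set x : R := n.+1%:R in n0 *.
(* The slack in the telescoping inequality is exactly [1 / (x (x + 1)^2)], which is visibly
   nonnegative. *)
have -> : 2 - (x + 1)^-1 - (2 - x^-1 + (x + 1) ^- 2) = (x * (x + 1) ^+ 2)^-1.
  by field; rewrite !gt_eqF//; lra.
by rewrite invr_ge0 mulr_ge0 ?sqr_ge0// ltW.
Qed.

(** Exchanging sum and integral, the series of the [q k] has finite integral. It is therefore finite
    almost everywhere, and the terms of a convergent series tend to 0. *)
Lemma ae_cvg0_of_summable_Rintegral d (T : measurableType d) (R : realType)
  (P : probability T R) (q : nat -> T -> R) (M : R) :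
  (forall k, measurable_fun setT (q k)) -> (forall k w, 0 <= q k w) ->
  (forall k, P.-integrable setT (EFin \o q k)) ->
  (forall n, \sum_(0 <= k < n) \int[P]_w q k w <= M) ->
  {ae P, forall w, q ^~ w @ \oo --> (0 : R)}.
Proof.
move=> mq q0 iq qM.
have mEq k : measurable_fun setT (EFin \o q k) by exact/measurable_EFinP.
have q0e k w : (0 <= (q k w)%:E)%E by rewrite lee_fin.
pose Q w := (\sum_(0 <= k <oo) (q k w)%:E)%E.
have iQ : P.-integrable setT Q.
  apply/integrableP; split.
    exact: (@ge0_emeasurable_sum _ _ _ _ _ xpredT (fun k w _ _ => q0e k w) (fun k _ => mEq k)).
  under eq_integral do rewrite gee0_abs ?nneseries_ge0 ?lee_fin//.
  rewrite integral_nneseries//.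
  apply: (@le_lt_trans _ _ M%:E); last exact: ltry.
  apply: lime_le.
    by apply: is_cvg_nneseries => k _ _; apply: integral_ge0 => w _; rewrite lee_fin.
  apply: nearW => n; rewrite (eq_bigr (fun k => (\int[P]_w q k w)%:E)).
    by rewrite sumEFin lee_fin.
  by move=> k _; rewrite fineK//; exact: (integrable_fin_num _ (iq k)).
have := integrable_ae measurableT iQ.
apply: filterS => w /(_ I) Qfin.
have Qlt : (Q w < +oo)%E by rewrite -ge0_fin_numE// nneseries_ge0// => k _ _; rewrite lee_fin.
have tail := @nneseries_tail_cvg _ (fun k => (q k w)%:E) xpredT Qlt.
have q0E : ((q k w)%:E @[k --> \oo] --> 0)%E.
  (* Each term is dominated by the tail that starts at it, and the tails of a finite nonnegative
     series vanish. *)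
  apply: (@squeeze_cvge _ _ _ _ (fun=> 0%E) _ (fun N => \sum_(N <= k <oo) (q k w)%:E)%E).
  - apply: nearW => N; rewrite lee_fin q0/=.
    have := @nneseries_lim_ge _ (fun k => (q k w)%:E) xpredT N N.+1.
    by rewrite big_nat1; apply => k _ _; rewrite lee_fin.
  - exact: cvg_cst.
  - by apply: tail => k; rewrite lee_fin.
by have /fine_cvgP[_] := q0E.
Qed.

(** The second moment of the mean at [n] is at most [n / n^2 = 1 / n], which is summable over
    squares; [cesaro_cvg0_squares] then recovers all indices. *)
Lemma ae_cesaro_cvg0_orthogonal d (T : measurableType d) (R : realType)
  (P : probability T R) (D : nat -> T -> R) :
  (forall i, measurable_fun setT (D i)) -> (forall i w, `|D i w| <= 1) ->
  (forall i j, (i != j)%N -> \int[P]_w (D i w * D j w) = 0) ->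
  {ae P, forall w, cesaro_mean (D ^~ w) @ \oo --> (0 : R)}.
Proof.
move=> mD D1 D0.
pose q k w := cesaro_mean (D ^~ w) (k.+1 ^ 2)%N ^+ 2.
have mq k : measurable_fun setT (q k).
  apply: measurable_funX; apply: measurable_funM => //; exact: measurable_sum.
have q1 k w : `|q k w| <= 1.
  by rewrite normrX exprn_ile1//; exact: cesaro_mean_normr_le.
have iq k : P.-integrable setT (EFin \o q k).
  exact: (@integrable_bounded _ _ _ _ _ 1).
have qle k : \int[P]_w q k w <= ((k.+1 ^ 2)%:R)^-1.
  have mS : measurable_fun setT (fun w => (\sum_(i < k.+1 ^ 2) D i w) ^+ 2).
    by apply: measurable_funX; exact: measurable_sum.
  rewrite /q /cesaro_mean; under eq_Rintegral do rewrite exprMn.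
  rewrite RintegralZl//.
    rewrite expr2 -mulrA ler_piMr ?invr_ge0// ler_pdivrMl ?ltr0n ?expn_gt0// mulr1.
    exact: Rintegral_sqr_sum_le.
  apply: (@integrable_bounded _ _ _ _ _ ((k.+1 ^ 2)%:R ^+ 2)) => // w.
  by rewrite normrX lerXn2r ?nnegrE// normr_sum_le_card.
have : {ae P, forall w, q ^~ w @ \oo --> (0 : R)}.
  apply: (@ae_cvg0_of_summable_Rintegral _ _ _ _ _ 2) => //.
    by move=> k w; exact: sqr_ge0.
  by move=> n; rewrite (le_trans (ler_sum _ (fun k _ => qle k)))// sum_inv_sqr_le2.
apply: filterS => w qw; apply: cesaro_cvg0_squares => //.
(* Since [q] is the square of the mean, precision [e ^+ 2] for [q] is precision [e] for the mean. *)
apply/cvgrPdist_le => e e0.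
move/cvgrPdist_le : qw => /(_ (e ^+ 2)); rewrite exprn_gt0// => /(_ isT).
apply: filterS => k; rewrite !sub0r !normrN /q normrX.
by rewrite ler_pXn2r// nnegrE ltW.
Qed.

(** * Measurability of events and functions, and integrated staircases *)

Lemma cvg0_sum (R : realType) (I : Type) (r : seq I) (u : I -> nat -> R) :
  (forall k, u k @ \oo --> (0 : R)) ->
  \sum_(k <- r) u k n @[n --> \oo] --> (0 : R).
Proof.
move=> u0; elim: r => [|k r IH].
  by under eq_fun do rewrite big_nil; exact: cvg_cst.
under eq_fun do rewrite big_cons.
have := cvgD (u0 k) IH; rewrite addr0; exact.
Qed.

(** The epsilon-N definition, with epsilon restricted to the values [1 / k.+1], uses only countable
    unions and intersections. *)
Lemma measurable_cvg0 d (T : measurableType d) (R : realType)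
  (h : nat -> T -> R) :
  (forall n, measurable_fun setT (h n)) ->
  measurable [set w | h ^~ w @ \oo --> (0 : R)].
Proof.
move=> mh.
have -> : [set w | h ^~ w @ \oo --> (0 : R)] =
    \bigcap_k \bigcup_N \bigcap_(n in [set n | (N <= n)%N])
      [set w | `|h n w| <= k.+1%:R^-1].
  apply/seteqP; split => w /=.
    move=> /cvgrPdist_le hw k _.
    have [N _ HN] := hw k.+1%:R^-1 ltac:(by rewrite invr_gt0).
    by exists N => // n Nn; have := HN n Nn; rewrite /= sub0r normrN.
  move=> hw; apply/cvgrPdist_le => e e0.
  have [k _ /(_ k (leqnn _)) /= ke] := near_infty_natSinv_lt (PosNum e0).
  have [N _ HN] := hw k I; exists N => // n Nn.
  by rewrite /= sub0r normrN (le_trans (HN n Nn))// ltW.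
apply: bigcapT_measurable => k; apply: bigcupT_measurable => N.
apply: bigcap_measurable => [|n _]; first by exists N => /=.
rewrite -[X in measurable X]setTI.
have mn : measurable_fun setT (fun w => `|h n w|) by exact: measurableT_comp.
rewrite (_ : [set w | _] = (fun w => `|h n w|) @^-1` `]-oo, k.+1%:R^-1]).
  exact: mn.
by apply/seteqP; split => w /=; rewrite in_itv.
Qed.

Lemma continuous_borel_measurable (R : realType) (S : ptopologicalType)
  (f : S -> R) : continuous f -> measurable_fun setT (f : borel S -> R).
Proof.
move=> /continuousP cf; apply: (measurability _ (RGenOpens.measurableE R)).
move=> _ [_ [a [b ->] <-]]; rewrite setTI.
by apply: sub_sigma_algebra; apply: cf; exact: interval_open.
Qed.

Lemma compact_continuous_bounded (R : realType) (S : topologicalType)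
  (f : S -> R) : compact [set: S] -> continuous f ->
  exists2 M, 0 < M & forall x, `|f x| <= M.
Proof.
move=> cS cf; have [M [_ HM]] : bounded_set (f @` [set: S]).
  by apply: compact_bounded; apply: continuous_compact => //; exact: continuous_subspaceT.
exists (`|M| + 1); first by rewrite ltr_wpDl.
move=> x; apply: (HM (`|M| + 1)); last by exists x.
by rewrite ltr_pwDr// ler_norm.
Qed.

(** Each generator is an event by [random_prob_measure], and the generated sigma-algebra is the
    smallest one containing them. *)
Lemma sigma_gen_measurable d (T : measurableType d) (R : realType)
  (S : ptopologicalType) (xi : nat -> T -> probability (borel S) R) :
  (forall i, random_prob_measure (xi i)) ->
  forall G, sigma_gen xi G -> measurable G.
Proof.
move=> mxi; apply: smallest_sub; first exact: sigma_algebra_measurable.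
move=> _ [i [f [B [cf mB ->]]]].
by rewrite -[X in measurable X]setTI; exact: (mxi i f cf measurableT B mB).
Qed.

Lemma fine_probability_itv d (T : measurableType d) (R : realType)
  (mu : probability T R) (A : set T) : measurable A -> 0 <= fine (mu A) <= 1.
Proof.
move=> mA; rewrite fine_ge0//= -lee_fin fineK ?probability_le1//.
exact: fin_num_measure.
Qed.

(** This integrates [staircase_approx]. The levels and the error do not depend on [mu], so one
    staircase serves all the random measures [xi i w] at once. *)
Lemma Rintegral_staircase_approx d (T : measurableType d) (R : realType)
  (mu : probability T R) (g : T -> R) (n : nat) :
  measurable_fun setT g -> (forall x, 0 <= g x <= 1) ->
  `|\int[mu]_x g x - n.+1%:R^-1 *
      \sum_(k < n.+1) fine (mu [set x | k.+1%:R / n.+1%:R <= g x])|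
    <= n.+1%:R^-1.
Proof.
move=> mg g01.
have mA c : measurable [set x | c <= g x] by exact: measurable_superlevel.
have mI c : measurable_fun setT (\1_[set x | c <= g x] : T -> R).
  exact: measurable_indic.
have iI c : mu.-integrable setT (EFin \o \1_[set x | c <= g x]).
  by apply: (@integrable_bounded _ _ _ _ _ 1) => // x; exact: normr_indic_le1.
pose s x : R := \sum_(k < n.+1) \1_[set t | k.+1%:R / n.+1%:R <= g t] x.
have ms : measurable_fun setT s by exact: measurable_sum.
have s1 x : `|s x| <= n.+1%:R.
  by apply: normr_sum_le_card => k; exact: normr_indic_le1.
rewrite (_ : \sum_(k < n.+1) _ = \int[mu]_x s x); last first.
  rewrite /s Rintegral_sum//; apply: eq_bigr => k _.
  by rewrite Rintegral_indic.
have is_ : mu.-integrable setT (EFin \o s).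
  exact: (@integrable_bounded _ _ _ _ _ n.+1%:R).
rewrite -RintegralZl// -RintegralB//.
- apply: normr_Rintegral_le; last by move=> x; exact: staircase_approx.
  by apply: measurable_funB => //; exact: measurable_funM.
- apply: (@integrable_bounded _ _ _ _ _ 1) => // x.
  by have /andP[? ?] := g01 x; rewrite ger0_norm.
- apply: (@integrable_bounded _ _ _ _ _ 1); first exact: measurable_funM.
  by move=> x; rewrite normrM ger0_norm// ler_pdivrMl// mulr1.
Qed.

(** * One- and two-coordinate consequences of the disintegration *)

(** Putting the whole space at every coordinate other than [i] turns the remaining factors into
    1. *)
Lemma disintegration_marginal d (T : measurableType d) (R : realType)
  (S : ptopologicalType) (P : probability T R) (X : nat -> T -> borel S)
  (xi : nat -> T -> probability (borel S) R) (i : nat) (A : set (borel S)) :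
  product_disintegration P X xi -> measurable A ->
  (forall B : set R, measurable B ->
     sigma_gen xi ((fun w => fine (xi i w A)) @^-1` B)) /\
  (forall G, sigma_gen xi G ->
     (P (X i @^-1` A `&` G) = \int[P]_(w in G) (fine (xi i w A))%:E)%E).
Proof.
move=> pd mA.
pose AA k := if k == i then A else setT.
have mAA k : measurable (AA k) by rewrite /AA; case: ifP.
have Y_E : (fun w => \prod_(k < i.+1) fine (xi k w (AA k))) =
    (fun w => fine (xi i w A)).
  apply/funext => w; rewrite big_ord_recr/= /AA eqxx big1 ?mul1r// => k _.
  by rewrite ltn_eqF//= [X in fine X](probability_setT (xi k w)).
have := pd i AA mAA; cbv zeta; rewrite Y_E => -[mY PY]; split => // G sG.
rewrite -PY//; congr (P (_ `&` _)); apply/seteqP; split => w /=.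
  by move=> Aw k _; rewrite /AA; case: eqP => // ->.
by move=> /(_ i (leqnn _)); rewrite /AA eqxx.
Qed.

(** The same device with two free coordinates, tested on the whole of [T]; [i != j] makes the two
    factors distinct terms of the product. *)
Lemma disintegration_pair d (T : measurableType d) (R : realType)
  (S : ptopologicalType) (P : probability T R) (X : nat -> T -> borel S)
  (xi : nat -> T -> probability (borel S) R) (i j : nat) (A : set (borel S)) :
  product_disintegration P X xi -> measurable A -> i != j ->
  (P (X i @^-1` A `&` X j @^-1` A) =
     \int[P]_w (fine (xi i w A) * fine (xi j w A))%:E)%E.
Proof.
move=> pd mA ij.
pose AA k := if (k == i) || (k == j) then A else setT.
have mAA k : measurable (AA k) by rewrite /AA; case: ifP.
pose m := maxn i j.
have im : (i < m.+1)%N by rewrite ltnS leq_maxl.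
have jm : (j < m.+1)%N by rewrite ltnS leq_maxr.
have Y_E : (fun w => \prod_(k < m.+1) fine (xi k w (AA k))) =
    (fun w => fine (xi i w A) * fine (xi j w A)).
  apply/funext => w; rewrite (bigD1 (Ordinal im))//= (bigD1 (Ordinal jm))/=; last first.
    by rewrite eq_sym.
  rewrite /AA !eqxx orbT /= big1 ?mulr1// => k /andP[ki kj].
  have /negbTE -> : val k != i by [].
  have /negbTE -> : val k != j by [].
  by rewrite /= [X in fine X](probability_setT (xi k w)).
have := pd m AA mAA; cbv zeta; rewrite Y_E => -[_ /(_ setT)]; rewrite setIT => <-.
  congr (P _); apply/seteqP; split => w /=.
    by move=> [Ai Aj] k _; rewrite /AA; case: eqP => [->//|_]; case: eqP => [->|].
  move=> H; split.
    by have := H i im; rewrite /AA eqxx.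
  by have := H j jm; rewrite /AA eqxx orbT.
(* What remains is that the whole of [T] lies in [sigma_gen xi]: it is the preimage of [setT] under
   a [sigma_gen xi]-measurable map. *)
have [] := @disintegration_marginal _ _ _ _ P X xi 0%N setT pd measurableT.
by move=> /(_ setT measurableT).
Qed.

(** * Almost sure convergence for indicators, then for continuous functions *)

Lemma ae_cesaro_indic d (T : measurableType d) (R : realType)
  (S : ptopologicalType) (P : probability T R) (X : nat -> T -> borel S)
  (xi : nat -> T -> probability (borel S) R) (A : set (borel S)) :
  (forall i, measurable_fun setT (X i)) ->
  (forall i, random_prob_measure (xi i)) ->
  product_disintegration P X xi -> measurable A ->
  {ae P, forall w, cesaro_mean (fun i => \1_A (X i w) - fine (xi i w A)) @ \oo
    --> (0 : R)}.
Proof.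
move=> mX mxi pd mA.
pose U i := X i @^-1` A.
have mU i : measurable (U i) by rewrite -[X in measurable X]setTI; exact: mX.
pose Y i w : R := fine (xi i w A).
have Y01 i w : 0 <= Y i w <= 1 by exact: fine_probability_itv.
have sY i := (@disintegration_marginal _ _ _ _ P X xi i A pd mA).1.
(* [random_prob_measure] speaks of continuous integrands only; for a Borel set [A] measurability
   comes from the disintegration, through [sigma_gen xi]. *)
have mY i : measurable_fun setT (Y i).
  by move=> _ B mB; rewrite setTI; exact: (sigma_gen_measurable mxi (sY i B mB)).
have mIU i : measurable_fun setT (\1_(U i) : T -> R) by exact: measurable_indic.
have D1 i w : `|\1_(U i) w - Y i w| <= 1.
  have := Y01 i w; rewrite indicE ler_norml.
  by case: (_ \in _) => /= /andP[]; lra.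
have Y1 i w : `|Y i w| <= 1 by have /andP[? ?] := Y01 i w; rewrite ger0_norm.
have mD i : measurable_fun setT (fun w => \1_(U i) w - Y i w).
  exact: measurable_funB.
(* [\1_(U i) - Y i] is orthogonal to every [Y j]: the superlevel sets of [Y j] belong to
   [sigma_gen xi], so the disintegration can be tested on them. *)
have cross i j : \int[P]_w ((\1_(U i) w - Y i w) * Y j w) = 0.
  apply: Rintegral_indicB_mul_eq0 => // c.
  apply: (@disintegration_marginal _ _ _ _ P X xi i A pd mA).2.
  have := sY j `[c, +oo[%classic ltac:(by []).
  by congr (sigma_gen xi _); apply/seteqP; split => w /=; rewrite in_itv/= andbT.
have iDY i j : P.-integrable setT (EFin \o (fun w => (\1_(U i) w - Y i w) * Y j w)).
  apply: (@integrable_bounded _ _ _ _ _ 1); first exact: measurable_funM.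
  by move=> w; rewrite normrM mulr_ile1.
have iYY i j : P.-integrable setT (EFin \o (fun w => Y i w * Y j w)).
  apply: (@integrable_bounded _ _ _ _ _ 1); first exact: measurable_funM.
  by move=> w; rewrite normrM mulr_ile1.
have iUU i j : P.-integrable setT (EFin \o \1_(U i `&` U j)).
  apply: (@integrable_bounded _ _ _ _ _ 1); last exact: normr_indic_le1.
  by apply: measurable_indic; exact: measurableI.
apply: (@ae_cesaro_cvg0_orthogonal _ _ _ P (fun i w => \1_(U i) w - Y i w)) => //.
move=> i j ij.
(* In this expansion the last two terms vanish by [cross], and the first two cancel in the integral
   by [disintegration_pair]. *)
have -> : \int[P]_w ((\1_(U i) w - Y i w) * (\1_(U j) w - Y j w)) =
    \int[P]_w (((\1_(U i `&` U j) w - Y i w * Y j w) -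
      (\1_(U i) w - Y i w) * Y j w) - (\1_(U j) w - Y j w) * Y i w).
  by apply: eq_Rintegral => w _; rewrite indicI /=; ring.
have iB1 : P.-integrable setT (EFin \o (fun w => \1_(U i `&` U j) w - Y i w * Y j w)).
  exact: (integrableB measurableT (iUU i j) (iYY i j)).
have iB2 : P.-integrable setT (EFin \o (fun w => (\1_(U i `&` U j) w - Y i w * Y j w)
    - (\1_(U i) w - Y i w) * Y j w)).
  exact: (integrableB measurableT iB1 (iDY i j)).
rewrite RintegralB// RintegralB// RintegralB// !cross !subr0.
rewrite Rintegral_indic; last exact: measurableI.
by rewrite (disintegration_pair pd mA ij) subrr.
Qed.

Lemma ae_cesaro_continuous d (T : measurableType d) (R : realType)
  (S : ptopologicalType) (P : probability T R) (X : nat -> T -> borel S)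
  (xi : nat -> T -> probability (borel S) R) (f : S -> R) :
  compact [set: S] -> (forall i, measurable_fun setT (X i)) ->
  (forall i, random_prob_measure (xi i)) ->
  product_disintegration P X xi -> continuous f ->
  {ae P, forall w, cesaro_mean (fun i => f (X i w) - mint (xi i w) f) @ \oo
    --> (0 : R)}.
Proof.
move=> cS mX mxi pd cf.
have [M M0 fM] := compact_continuous_bounded cS cf.
have mf := continuous_borel_measurable cf.
(* [f] is rescaled affinely to take values in [0, 1], as the staircase lemmas require. *)
pose g (x : borel S) := (f x + M) / (2 * M).
have mg : measurable_fun setT g.
  by apply: measurable_funM => //; exact: measurable_funD.
have g01 x : 0 <= g x <= 1.
  have := fM x; rewrite ler_norml => /andP[h1 h2].
  by rewrite /g divr_ge0/= ?ler_pdivrMr; lra.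
have fE x : f x = 2 * M * g x - M.
  by rewrite /g; field; rewrite gt_eqF.
pose A n k : set (borel S) := [set x | k.+1%:R / n.+1%:R <= g x].
have mA n k : measurable (A n k) by exact: measurable_superlevel.
have mintE (mu : probability (borel S) R) :
    mint mu f = 2 * M * \int[mu]_x g x - M.
  have ig : mu.-integrable setT (EFin \o g).
    apply: (@integrable_bounded _ _ _ _ _ 1) => // x.
    by have /andP[? ?] := g01 x; rewrite ger0_norm.
  have i2g : mu.-integrable setT (EFin \o (fun x => 2 * M * g x)).
    exact: (integrableZl measurableT (2 * M) ig).
  rewrite /mint (_ : f = fun x => 2 * M * g x - M); last exact/funext.
  rewrite RintegralB//; last first.
    by apply: (@integrable_bounded _ _ _ _ _ `|M|).
  by rewrite RintegralZl// Rintegral_cst// [X in fine X](probability_setT mu) mulr1.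
(* The sets [A n k] form a countable family fixed before [w] and [e], so a single null set serves
   every precision. *)
have : {ae P, forall w, forall n k, cesaro_mean
    (fun i => \1_(A n k) (X i w) - fine (xi i w (A n k))) @ \oo --> (0 : R)}.
  by apply: ae_foralln => n; apply: ae_foralln => k; exact: ae_cesaro_indic.
apply: filterS => w Aw; apply: cesaro_cvg0_approx => e e0.
(* Two staircase errors, one at [X i w] and one under [xi i w], are each scaled by [2 * M], for a
   total of [4 * M / n.+1 < e]. *)
have eM : 0 < e / (4 * M) by rewrite divr_gt0// mulr_gt0.
have [n _ /(_ n (leqnn _)) /= ne] := near_infty_natSinv_lt (PosNum eM).
exists (fun i => 2 * M * n.+1%:R^-1 *
    \sum_(k < n.+1) (\1_(A n k) (X i w) - fine (xi i w (A n k)))).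
  rewrite (_ : cesaro_mean _ = fun m => 2 * M * n.+1%:R^-1 * \sum_(k < n.+1)
      cesaro_mean (fun i => \1_(A n k) (X i w) - fine (xi i w (A n k))) m); last first.
    by apply/funext => m; rewrite cesaro_meanZ cesaro_mean_sum.
  rewrite -[X in _ --> X](mulr0 (2 * M * n.+1%:R^-1)).
  apply: cvgM; first exact: cvg_cst.
  by apply: cvg0_sum => k; exact: Aw.
move=> i; rewrite fE mintE sumrB.
have h1 := staircase_approx n (g01 (X i w)).
have h2 := @Rintegral_staircase_approx _ _ _ (xi i w) g n mg g01.
rewrite ltr_pdivlMr ?mulr_gt0// in ne.
set a := \sum_(k < _) _ in h1 *; set b := \sum_(k < _) _ in h2 *.
have -> : 2 * M * g (X i w) - M - (2 * M * \int[xi i w]_x g x - M) -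
    2 * M * n.+1%:R^-1 * (a - b) = 2 * M * ((g (X i w) - n.+1%:R^-1 * a) -
    (\int[xi i w]_x g x - n.+1%:R^-1 * b)) by ring.
have h := le_trans (ler_normB _ _) (lerD h1 h2).
have M2 : 0 < 2 * M by rewrite mulr_gt0.
rewrite normrM (gtr0_norm M2).
apply: le_trans (ler_wpM2l (ltW M2) h) _; apply: le_trans (ltW ne).
by rewrite le_eqVlt; apply/orP; left; apply/eqP; ring.
Qed.

Theorem theorem1 (R : realType) (S : pseudoPMetricType R)
  (d : measure_display) (T : measurableType d) (P : probability T R)
  (X : nat -> T -> borel S) (xi : nat -> T -> probability (borel S) R)
  (f : S -> R) :
  compact [set: S] -> hausdorff_space S ->
  (forall i, measurable_fun setT (X i)) ->
  (forall i, random_prob_measure (xi i)) ->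
  product_disintegration P X xi ->
  continuous f ->
  (measurable [set w | ((cesaro_mean (fun i : nat => f (X i w) - mint (xi i w) f)) @ \oo --> (0 : R))]
   /\ P [set w | ((cesaro_mean (fun i : nat => f (X i w) - mint (xi i w) f)) @ \oo --> (0 : R))] = 1%E)
  /\
  (({ae P, forall w, cvgn (cesaro_mean (fun i : nat => f (X i w)))} <->
    {ae P, forall w, cvgn (cesaro_mean (fun i : nat => mint (xi i w) f))})
   /\
   ({ae P, forall w, cvgn (cesaro_mean (fun i : nat => f (X i w)))} ->
    {ae P, forall w, limn (cesaro_mean (fun i : nat => f (X i w)))
                     = limn (cesaro_mean (fun i : nat => mint (xi i w) f))})).
Proof.
move=> cS _ mX mxi pd cf.
have key := ae_cesaro_continuous cS mX mxi pd cf.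
have mf := continuous_borel_measurable cf.
have mfX i : measurable_fun setT (fun w => f (X i w)).
  exact: (measurableT_comp mf (mX i)).
have mC : measurable [set w | cesaro_mean (fun i => f (X i w) - mint (xi i w) f) @ \oo
    --> (0 : R)].
  apply: measurable_cvg0 => n; apply: measurable_funM => //.
  by apply: measurable_sum => i; apply: measurable_funB => //; exact: mxi.
(* For a fixed trajectory, adding a null sequence preserves the limit [l]. This and its converse
   [toxi] give both directions and the equality of the limits. *)
have fromxi w l : cesaro_mean (fun i => f (X i w) - mint (xi i w) f) @ \oo --> (0 : R) ->
    cesaro_mean (fun i => mint (xi i w) f) @ \oo --> l ->
    cesaro_mean (fun i => f (X i w)) @ \oo --> (l : R).
  move=> h0 hl; rewrite -[l]add0r.
  rewrite (_ : cesaro_mean (fun i => f (X i w)) =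
      cesaro_mean (fun i => f (X i w) - mint (xi i w) f) \+
      cesaro_mean (fun i => mint (xi i w) f)); first exact: cvgD.
  by apply/funext => n /=; rewrite cesaro_meanB subrK.
have toxi w l : cesaro_mean (fun i => f (X i w) - mint (xi i w) f) @ \oo --> (0 : R) ->
    cesaro_mean (fun i => f (X i w)) @ \oo --> l ->
    cesaro_mean (fun i => mint (xi i w) f) @ \oo --> (l : R).
  move=> h0 hl; rewrite -[l]subr0.
  rewrite (_ : cesaro_mean (fun i => mint (xi i w) f) =
      cesaro_mean (fun i => f (X i w)) \-
      cesaro_mean (fun i => f (X i w) - mint (xi i w) f)); first exact: cvgB.
  by apply/funext => n /=; rewrite cesaro_meanB subKr.
split; [split => //|split; [split|]].
(* [key] makes the complement negligible; as the event is measurable, its probability is exactly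
   1. *)
- have := probability_setC P (measurableC mC).
  by rewrite setCK (measure_negligible (measurableC mC) key : P _ = 0%E) sube0.
- by apply: filterS2 key => w h0 /cvg_ex[l hl]; apply/cvg_ex; exists l; exact: toxi.
- by apply: filterS2 key => w h0 /cvg_ex[l hl]; apply/cvg_ex; exists l; exact: fromxi.
- apply: filterS2 key => w h0 /cvg_ex[l hl].
  by rewrite (cvg_lim _ hl)// (cvg_lim _ (toxi w l h0 hl)).
Qed.
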